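(* Let $\Phi$ and $\Phi'$ be positive stable $3$-forms on $\mathbb{R}^7$, and let $p,p'\in\mathbb{R}^7$ be unit vectors with respect to the inner products determined by $\Phi$ and $\Phi'$ respectively. Then the algebras $\mathbb{V}_{7,p,\Phi}$ and $\mathbb{V}_{7,p',\Phi'}$ are isomorphic.
   Context: Let $\omega^1,\dots,\omega^7$ be the standard dual basis of $\mathbb{R}^7$, $\omega^{ijk}=\omega^i\wedge\omega^j\wedge\omega^k$, and $$\Phi_0=\omega^{123}+\omega^{145}+\omega^{167}+\omega^{246}-\omega^{257}-\omega^{347}-\omega^{356}.$$ A positive stable $3$-form on $\mathbb{R}^7$ is an alternating trilinear form of the form $A^*\Phi_0$ for some $A\in GL(7,\mathbb{R})$. Such a form $\Phi$ determines a unique compatible inner product $g_\Phi$ on $\mathbb{R}^7$: the unique inner product for which the bilinear map $\times_\Phi$ defined by $g_\Phi(u\times_\Phi v,w)=\Phi(u,v,w)$ is a vector cross product, i.e. is skew-symmetric, has $u\times_\Phi v$ orthogonal to $u$ and $v$, and satisfies $|u\times_\Phi v|^2=|u|^2|v|^2-g_\Phi(u,v)^2$ (norms with respect to $g_\Phi$). (For $\Phi=A^*\Phi_0$, $g_\Phi$ is the pullback by $A$ of the Euclidean inner product.) For a vector $p$ with $g_\Phi(p,p)=1$, $\mathbb{V}_{7,p,\Phi}$ is $\mathbb{R}^7$ with the bilinear product $$a\veebar_{p,\Phi}b=g_\Phi(a,p)\,b+g_\Phi(b,p)\,a-g_\Phi(a,b)\,p+g_\Phi(p,a\times_\Phi b)\,p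 .$$ Isomorphism means isomorphism of $\mathbb{R}$-algebras. *)

(* Defs.v *)
From mathcomp Require Import all_boot all_order all_algebra.
From mathcomp Require Import all_classical all_reals.

Set Implicit Arguments.
Unset Strict Implicit.
Unset Printing Implicit Defensive.

Import Order.TTheory GRing.Theory Num.Theory.
Local Open Scope classical_set_scope.
Local Open Scope ring_scope.

Section Forms.
Variable R : realType.

Notation V := 'cV[R]_7.

Definition form2 := V -> V -> R.
Definition form3 := V -> V -> V -> R.

(* omega^i for 1 <= i <= 7: the mathematical indices start at 1, those of
   'I_7 at 0. *)
Definition coform (i : nat) (u : V) : R := u (inord i.-1) 0.

(* The wedge product is normalised without a factor 1/3!, i.e.
   (a /\ b /\ c)(u, v, w) is the determinant of the evaluations. *)
Definition omega (i j k : nat) : form3 := fun u v w =>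
  \det (\matrix_(r < 3, c < 3)
    coform (nth 0%N [:: i; j; k] c) (nth 0 [:: u; v; w] r)).

Definition Phi0 : form3 := fun u v w =>
  omega 1 2 3 u v w + omega 1 4 5 u v w + omega 1 6 7 u v w
  + omega 2 4 6 u v w - omega 2 5 7 u v w
  - omega 3 4 7 u v w - omega 3 5 6 u v w.

Definition pullback (A : 'M[R]_7) (Phi : form3) : form3 :=
  fun u v w => Phi (A *m u) (A *m v) (A *m w).

(* Trilinearity and alternation of Phi are inherited from Phi0. *)
Definition positive_stable (Phi : form3) : Prop :=
  exists2 A : 'M[R]_7, A \in unitmx & Phi = pullback A Phi0.

Definition inner_product (g : form2) : Prop :=
  [/\ forall v, scalar (g^~ v),
      forall u, scalar (g u),
      forall u v, g u v = g v u
    & forall u, u != 0 -> 0 < g u u].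

(* u x v is the vector representing Phi(u, v, _) through g. It exists and is
   unique when g is an inner product and Phi is trilinear. *)
Definition cross (g : form2) (Phi : form3) (u v : V) : V :=
  xget 0 [set x | forall w, g x w = Phi u v w].

Definition vector_cross_product (g : form2) (X : V -> V -> V) : Prop :=
  [/\ forall u v, X u v = - X v u,
      forall u v, g (X u v) u = 0,
      forall u v, g (X u v) v = 0
    & forall u v, g (X u v) (X u v) = g u u * g v v - g u v ^+ 2].

Definition compatible (Phi : form3) (g : form2) : Prop :=
  inner_product g /\ vector_cross_product g (cross g Phi).

(* For Phi positive stable there is exactly one compatible inner product; the
   default value 0 is used only for the other forms. *)
Definition metric (Phi : form3) : form2 :=
  xget (fun _ _ => 0) [set g | compatible Phi g].

Definition veebar (p : V) (Phi : form3) (a b : V) : V :=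
  let g := metric Phi in
  g a p *: b + g b p *: a - g a b *: p + g p (cross g Phi a b) *: p.

End Forms.

(* The algebras are neither unital nor associative: an algebra is a module U
   together with a product U -> U -> U. *)
Definition algebra_isomorphic (R : realType) (U U' : lmodType R)
    (m : U -> U -> U) (m' : U' -> U' -> U') : Prop :=
  exists2 f : {linear U -> U'}, bijective f
    & forall a b, f (m a b) = m' (f a) (f b).

(* Main.v *)
Require Import Defs.
From mathcomp Require Import all_boot all_order all_algebra.
From mathcomp Require Import all_classical all_reals.
From mathcomp Require Import ring lra zify.
Set Implicit Arguments.
Unset Strict Implicit.
Unset Printing Implicit Defensive.
Import Order.TTheory GRing.Theory Num.Theory.
Local Open Scope ring_scope.

(** Write g for the metric of Phi, and J u = p x u. Since g(p, a x b) =
Phi(p, a, b) = g(J a, b), the product depends on Phi only through g, p and the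
skew form om = Phi(p, _, _), that is, through J. The cross product axioms say
that J p = 0 and |J u|^2 = |u|^2 - g(u, p)^2, so that J is an orthogonal
complex structure on the 6-dimensional space orthogonal to p. Such a triple
(g, p, J) is unique up to linear isomorphism: p, w_0, J w_0, w_1, J w_1, w_2,
J w_2 is an orthonormal basis when (w_0, w_1, w_2) is a unitary basis of the
orthogonal of p, and in such a basis g and om have fixed tables. Hence each
algebra is isomorphic to one standard algebra on R^7 ([veebar_normal_form]),
and two of them are isomorphic to each other.

Positivity of Phi guarantees that the metric is compatible with Phi, so that the
cross product axioms can be applied ([metric_compatible]): the pullback of the
dot product is a compatible inner product, by the identity |u x v|^2 =
|u|^2 |v|^2 - (u.v)^2 for the standard form ([cross0_norm]). *)

(** * The standard 3-form and its cross product *)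

Section StandardForm.
Variable R : realType.
Local Notation V := 'cV[R]_7.
Implicit Types (u v w : V).

Definition dot u v : R := \sum_i u i 0 * v i 0.

(** The coordinates of the standard form are indexed from 1; this puts the dot
product in the same terms, so that the identities below are polynomial
identities in common variables. *)
Lemma dotE u v : dot u v =
  coform 1 u * coform 1 v + coform 2 u * coform 2 v + coform 3 u * coform 3 v +
  coform 4 u * coform 4 v + coform 5 u * coform 5 v + coform 6 u * coform 6 v +
  coform 7 u * coform 7 v.
Proof.
rewrite /dot /coform !big_ord_recr big_ord0 /= add0r.
by do 7?congr (_ + _); congr (_ * _); congr (_ _ 0); apply/val_inj;
  rewrite /= inordK.
Qed.

Lemma omegaE i j k u v w : omega i j k u v w =
  coform i u * (coform j v * coform k w - coform k v * coform j w)
  - coform j u * (coform i v * coform k w - coform k v * coform i w)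
  + coform k u * (coform i v * coform j w - coform j v * coform i w).
Proof.
rewrite /omega (expand_det_row _ ord0) !big_ord_recl big_ord0 /cofactor.
rewrite !(expand_det_row _ ord0) !big_ord_recl !big_ord0 /cofactor.
rewrite !det_mx11 !mxE /=.
ring.
Qed.

Lemma coform_linear i : scalar (@coform R i).
Proof. by move=> a u v; rewrite /coform !mxE. Qed.

Lemma coform_delta i (k : 'I_7) : (0 < i <= 7)%N ->
  coform i (delta_mx k 0 : V) = (i == k.+1)%:R.
Proof.
move=> /andP[i0 i7]; rewrite /coform mxE eqxx andbT -val_eqE /= inordK.
  by case: i i0 i7.
by case: i i0 i7.
Qed.

Lemma Phi0_linear3 u v : scalar (Phi0 u v).
Proof. by move=> a w w'; rewrite /Phi0 !omegaE !coform_linear; ring. Qed.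

Lemma Phi0_skew12 u v w : Phi0 u v w = - Phi0 v u w.
Proof. by rewrite /Phi0 !omegaE; ring. Qed.

Lemma Phi0_skew23 u v w : Phi0 u v w = - Phi0 u w v.
Proof. by rewrite /Phi0 !omegaE; ring. Qed.

(** The only candidate for the vector that represents Phi0 u v _ for the dot
product: its k-th coordinate is its product with the k-th basis vector. *)
Definition cross0 u v : V := \col_k Phi0 u v (delta_mx k 0).

Lemma coform_cross0 i u v :
  coform i (cross0 u v) = Phi0 u v (delta_mx (inord i.-1) 0).
Proof. by rewrite /coform mxE. Qed.

Lemma dot_cross0 u v w : dot (cross0 u v) w = Phi0 u v w.
Proof.
rewrite dotE !coform_cross0 /Phi0 !omegaE !coform_delta // !inordK //=.
ring.
Qed.

(** The seven triples of indices in the standard form are the lines of a Fano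
plane, with the signs of the octonion product. This makes the identity hold:
it says that the octonion norm is multiplicative. It is checked here by
expansion, as an identity of polynomials in the 14 coordinates. *)
Lemma cross0_norm u v :
  dot (cross0 u v) (cross0 u v) = dot u u * dot v v - dot u v ^+ 2.
Proof.
rewrite dotE !coform_cross0 /Phi0 !omegaE !coform_delta // !inordK //= !dotE.
ring.
Qed.

Lemma dot_inner_product : inner_product dot.
Proof.
have dotC u v : dot u v = dot v u.
  by apply: eq_bigr => i _; rewrite mulrC.
have dot_linear u : scalar (dot u).
  by move=> a v w; rewrite !dotE !coform_linear; ring.
split=> // [v a u w|u u0]; first by rewrite !(dotC _ v) dot_linear.
have dot_ge0 i : true -> 0 <= u i 0 * u i 0 by rewrite -expr2 sqr_ge0.
rewrite lt_neqAle sumr_ge0 // andbT eq_sym; apply: contra u0 => /eqP duu.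
apply/eqP/colP => i; rewrite mxE.
by have /(_ i isT)/eqP := psumr_eq0P dot_ge0 duu; rewrite mulf_eq0 orbb => /eqP.
Qed.

End StandardForm.

(** * Linear forms and inner products on R^7 *)

Section LinearForm.
Variables (R : realType) (f : 'cV[R]_7 -> R).
Hypothesis f_linear : scalar f.

Lemma scalarD u v : f (u + v) = f u + f v.
Proof. by rewrite -[u in LHS]scale1r f_linear mul1r. Qed.

Lemma scalar0 : f 0 = 0.
Proof. by apply: (addrI (f 0)); rewrite -scalarD !addr0. Qed.

Lemma scalarZ a u : f (a *: u) = a * f u.
Proof. by rewrite -[a *: u]addr0 f_linear scalar0 addr0. Qed.

Lemma scalarN u : f (- u) = - f u.
Proof. by rewrite -scaleN1r scalarZ mulN1r. Qed.

Lemma scalar_mulmx (M : 'M[R]_7) u : f (M *m u) = \sum_i u i 0 * f (col i M).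
Proof.
have -> : M *m u = \sum_i u i 0 *: col i M.
  apply/colP => k; rewrite !mxE summxE; apply: eq_bigr => i _.
  by rewrite !mxE mulrC.
rewrite (big_morph f scalarD scalar0); apply: eq_bigr => i _.
by rewrite scalarZ.
Qed.

End LinearForm.

Section InnerProduct.
Variables (R : realType) (g : form2 R).
Hypothesis g_inner : inner_product g.
Local Notation V := 'cV[R]_7.
Implicit Types (u v w : V).

Let g_linearl v : scalar (g^~ v). Proof. by case: g_inner. Qed.
Let g_linearr u : scalar (g u). Proof. by case: g_inner. Qed.
Let gC u v : g u v = g v u. Proof. by case: g_inner. Qed.
Let g_gt0 u : u != 0 -> 0 < g u u. Proof. by case: g_inner => _ _ _; apply. Qed.

Lemma inner_product_inj u v : (forall w, g u w = g v w) -> u = v.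
Proof.
move=> guv; apply/eqP; rewrite -subr_eq0; apply: contraT => /g_gt0.
by rewrite (scalarD (g_linearl _)) (scalarN (g_linearl _)) guv subrr ltxx.
Qed.

Definition gram : 'M[R]_7 := \matrix_(i, j) g (delta_mx i 0) (delta_mx j 0).

Lemma gramE u v : g u v = (u^T *m gram *m v) 0 0.
Proof.
rewrite -[u in LHS]mul1mx (scalar_mulmx (g_linearl _)).
rewrite -mulmxA mxE; apply: eq_bigr => i _; rewrite !mxE; congr (_ * _).
rewrite -[v in LHS]mul1mx (scalar_mulmx (g_linearr _)); apply: eq_bigr => j _.
by rewrite mxE mulrC !colE !mul1mx.
Qed.

Lemma gram_unit : gram \in unitmx.
Proof.
rewrite -row_free_unit -kermx_eq0; apply/rowV0P => v /sub_kermxP vG.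
suff vT0 : v^T = 0 by rewrite -[v]trmxK vT0 trmx0.
by apply: inner_product_inj => w; rewrite !gramE trmxK vG trmx0 !mul0mx.
Qed.

(** The Gram matrix is invertible because g is definite, and the representing
vector is obtained by applying its inverse to the coefficients of f. *)
Lemma riesz (f : V -> R) : scalar f -> exists u, forall w, g u w = f w.
Proof.
move=> f_linear; pose r := \row_j f (delta_mx j 0).
exists (r *m invmx gram)^T => w.
rewrite gramE trmxK mulmxKV ?gram_unit //.
rewrite -[w in RHS]mul1mx (scalar_mulmx f_linear) mxE; apply: eq_bigr => j _.
by rewrite mxE mulrC colE mul1mx.
Qed.

(** The cross product is defined by choice, with a default value;
representability of the linear form makes the choice a genuine one. *)
Lemma crossE (Phi : form3 R) u v w :
  scalar (Phi u v) -> g (cross g Phi u v) w = Phi u v w.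
Proof.
by move=> /riesz Phi_riesz; move: w; apply: (xgetPex 0 Phi_riesz).
Qed.

(** Fewer than 7 linear equations in R^7 have a nonzero solution, which is then
normalised. *)
Lemma orthogonal_unit_vector (s : seq V) : (size s < 7)%N ->
  exists2 u, g u u = 1 & forall v, v \in s -> g u v = 0.
Proof.
move=> s_lt7; pose B := \matrix_(i < 7, j < size s) g (delta_mx i 0) s`_j.
have : kermx B != 0.
  rewrite -mxrank_eq0 mxrank_ker subn_eq0 -ltnNge.
  exact: leq_ltn_trans (rank_leq_col _) s_lt7.
move=> /rowV0Pn[v /sub_kermxP vB v0].
have u_gt0 : 0 < g v^T v^T by apply: g_gt0; rewrite trmx_eq0.
exists ((Num.sqrt (g v^T v^T))^-1 *: v^T) => [|w].
  rewrite (scalarZ (g_linearl _)) (scalarZ (g_linearr _)) mulrA -expr2 exprVn.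
  by rewrite sqr_sqrtr ?ltW // mulVf // gt_eqF.
move=> /(nthP 0)[j js <-]; rewrite (scalarZ (g_linearl _)).
suff -> : g v^T s`_j = 0 by rewrite mulr0.
have /rowP/(_ (Ordinal js)) := vB; rewrite !mxE => <-.
rewrite -[v^T]mul1mx (scalar_mulmx (g_linearl _)); apply: eq_bigr => i _.
by rewrite !mxE colE mul1mx.
Qed.

(** * Unitary bases of the orthogonal of p *)

(** In the application om is Phi(p, _, _) and J is the cross product with p. *)
Variables (om : form2 R) (J : V -> V) (p : V).
Hypothesis om_linear : forall u, scalar (om u).
Hypothesis om_skew : forall u v, om u v = - om v u.
Hypothesis omp : forall u, om u p = 0.
Hypothesis gJ : forall u v, g (J u) v = om u v.
Hypothesis gp : g p p = 1.
Hypothesis gJJ : forall u, g (J u) (J u) = g u u - g u p ^+ 2.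

Let om_linearl v : scalar (om^~ v).
Proof. by move=> a u w; rewrite !(om_skew _ v) om_linear /= opprD mulrN. Qed.

Let JD u v : J (u + v) = J u + J v.
Proof.
apply: inner_product_inj => w.
by rewrite (scalarD (g_linearl _)) !gJ (scalarD (om_linearl _)).
Qed.

(** Polarisation of the hypothesis on |J u|^2: J is an isometry on the
orthogonal of p. *)
Lemma hermitian_polar u v : g (J u) (J v) = g u v - g u p * g v p.
Proof.
have := gJJ (u + v).
rewrite JD !(scalarD (g_linearl _)) !(scalarD (g_linearr _)) !gJJ.
rewrite (gC (J v) (J u)) (gC v u) => polar.
lra.
Qed.

Lemma om_self u : om u u = 0.
Proof. have := om_skew u u; lra. Qed.

(** An orthonormal system for the Hermitian form with real part g and imaginary
part om on the orthogonal of p, built one vector at a time. A new vector x has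
to be orthogonal to p, to the w_i and to the J w_i, which are
2m + 1 conditions; orthogonality to J w_i gives om (w_i) x = 0. *)
Lemma unitary_system m : (m.*2 < 7)%N -> exists w : nat -> V,
  forall i j, (i < m)%N -> (j < m)%N ->
    [/\ g (w i) p = 0, g (w i) (w j) = (i == j)%:R & om (w i) (w j) = 0].
Proof.
elim: m => [|m IHm] m_lt7; first by exists (fun=> 0).
have [|w wP] := IHm; first by lia.
pose s := p :: [seq w i | i <- iota 0 m] ++ [seq J (w i) | i <- iota 0 m].
have [|x x1 xs] := @orthogonal_unit_vector s.
  by rewrite /= size_cat !size_map size_iota addnn -doubleS; lia.
have xp : g x p = 0 by apply: xs; rewrite inE eqxx.
have xw i : (i < m)%N -> g x (w i) = 0.
  by move=> im; apply: xs; rewrite inE mem_cat map_f ?orbT // mem_iota.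
have wx i : (i < m)%N -> om (w i) x = 0.
  move=> im; rewrite -gJ gC; apply: xs.
  by rewrite inE mem_cat [X in _ || X]orbC (map_f (J \o w)) ?orbT // mem_iota.
exists (fun i => if (i < m)%N then w i else x) => i j i_le j_le.
case: (ltnP i m) => im; case: (ltnP j m) => jm.
- exact: wP.
- have -> : j = m by lia.
  by case: (wP i i im im) => wip _ _; rewrite ltn_eqF // (gC _ x) xw // wx.
- have -> : i = m by lia.
  case: (wP j j jm jm) => wjp _ _; rewrite gtn_eqF // xw //.
  by rewrite om_skew wx // oppr0.
- have [-> ->] : i = m /\ j = m by lia.
  by rewrite eqxx om_self.
Qed.

(** The values of om on the basis p, w_0, J w_0, w_1, J w_1, w_2, J w_2,
numbered from 0: w_k has index 2k + 1 and J w_k has index 2k + 2, so that both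
have i.-1./2 = k, and the parity of i tells which of the two it is. *)
Definition hermitian_table (i j : nat) : R :=
  [&& (0 < i)%N, (0 < j)%N & i.-1./2 == j.-1./2]%:R
  * ((odd i && ~~ odd j)%:R - (~~ odd i && odd j)%:R).

Lemma unitary_frame : exists e : 'I_7 -> V,
  [/\ e 0 = p, forall i j, g (e i) (e j) = (i == j)%:R
    & forall i j, om (e i) (e j) = hermitian_table i j].
Proof.
have [//|w wP] := @unitary_system 3.
have wp i : (i < 3)%N -> g (w i) p = 0 by move=> i3; case: (wP i i i3 i3).
have ww i j : (i < 3)%N -> (j < 3)%N -> g (w i) (w j) = (i == j)%:R.
  by move=> i3 j3; case: (wP i j i3 j3).
have omw i j : (i < 3)%N -> (j < 3)%N -> om (w i) (w j) = 0.
  by move=> i3 j3; case: (wP i j i3 j3).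
have pom u : om p u = 0 by rewrite om_skew omp oppr0.
have omJ u v : om u (J v) = g u v - g u p * g v p.
  by rewrite -gJ hermitian_polar.
have omJl u v : om (J u) v = - (g u v - g u p * g v p).
  by rewrite om_skew omJ gC [g v p * _]mulrC.
have Jp u : g (J u) p = 0 by rewrite gJ.
have pJ u : g p (J u) = 0 by rewrite gC.
have gJr u v : g u (J v) = om v u by rewrite gC gJ.
pose e (i : 'I_7) := if i == 0 :> nat then p
  else if odd i then w i.-1./2 else J (w i.-1./2).
exists e; split=> // i j; rewrite /e.
all: have i3 : (i.-1./2 < 3)%N by have := ltn_ord i; lia.
all: have j3 : (j.-1./2 < 3)%N by have := ltn_ord j; lia.
- rewrite -val_eqE /=.
  case: (eqVneq (i : nat) 0) => [->|i0]; case: (eqVneq (j : nat) 0) => j0.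
  + by rewrite gp.
  + by case: (odd j); rewrite ?pJ // gC wp.
  + by rewrite j0 (negPf i0); case: (odd i); rewrite ?Jp ?wp.
  + case: (boolP (odd i)) => oi; case: (boolP (odd j)) => oj.
    * by rewrite ww //; congr (nat_of_bool _)%:R; lia.
    * by rewrite gJr omw // [_ == _](_ : _ = false) //; lia.
    * by rewrite gJ omw // [_ == _](_ : _ = false) //; lia.
    * rewrite hermitian_polar !wp // mulr0 subr0 ww //.
      by congr (nat_of_bool _)%:R; lia.
- rewrite /hermitian_table.
  case: (posnP i) => [i0|i_gt0]; first by rewrite pom mul0r.
  case: (posnP j) => [j0|j_gt0]; first by rewrite omp mul0r.
  case: (odd i); case: (odd j) => /=.
  + by rewrite omw // subrr mulr0.
  + by rewrite omJ !wp // mulr0 !subr0 mulr1 ww.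
  + by rewrite omJl !wp // mulr0 subr0 sub0r mulrN mulr1 ww.
  + by rewrite omJl wp // gJr omw // mul0r subr0 oppr0 mulr0.
Qed.

(** M is the matrix of the unitary basis. It is invertible because its columns
are orthonormal: M^T G M = 1 for the Gram matrix G of g. *)
Lemma unitary_normal_form : exists2 M : 'M[R]_7, M \in unitmx &
  [/\ M *m delta_mx 0 0 = p, forall u v, g (M *m u) (M *m v) = dot u v
    & forall u v, om (M *m u) (M *m v) =
        \sum_i u i 0 * \sum_j v j 0 * hermitian_table i j].
Proof.
have [e [e0 ge ome]] := unitary_frame.
pose M := \matrix_(i, j) e j i 0.
have colM i : col i M = e i by apply/colP => k; rewrite !mxE.
have gM u v : g (M *m u) (M *m v) = dot u v.
  rewrite (scalar_mulmx (g_linearl _)); apply: eq_bigr => i _; congr (_ * _).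
  rewrite (scalar_mulmx (g_linearr _)) (bigD1 i) //= !colM ge eqxx mulr1.
  rewrite big1 ?addr0 // => j ji.
  by rewrite !colM ge eq_sym (negPf ji) mulr0.
exists M.
  suff /mulmx1_unit[_ //] : (M^T *m gram) *m M = 1%:M.
  apply/matrixP => i j; rewrite [RHS]mxE -ge -!colM gramE tr_col -row_mul.
  by rewrite [LHS]mxE [RHS]mxE; apply: eq_bigr => k _; rewrite !mxE.
split=> // [|u v]; first by rewrite -colE colM.
rewrite (scalar_mulmx (om_linearl _)); apply: eq_bigr => i _; congr (_ * _).
rewrite (scalar_mulmx (om_linear _)); apply: eq_bigr => j _.
by rewrite !colM ome.
Qed.

End InnerProduct.

(** * Reduction to a standard algebra *)

(** The product of the statement with g the dot product, p the first basis
vector, and om given by the standard table. *)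
Definition standard_product (R : realType) (a b : 'cV[R]_7) : 'cV[R]_7 :=
  let q : 'cV[R]_7 := delta_mx 0 0 in
  dot a q *: b + dot b q *: a - dot a b *: q
  + (\sum_i a i 0 * \sum_j b j 0 * hermitian_table R i j) *: q.

Section PositiveForms.
Variables (R : realType) (Phi : form3 R).
Hypothesis Phi_positive : positive_stable Phi.

Lemma positive_stable_linear3 u v : scalar (Phi u v).
Proof.
case: Phi_positive => A _ -> a w w'.
by rewrite /pullback mulmxDr -scalemxAr Phi0_linear3.
Qed.

Lemma positive_stable_skew23 u v w : Phi u v w = - Phi u w v.
Proof. by case: Phi_positive => A _ ->; apply: Phi0_skew23. Qed.

Lemma positive_stable_skew12 u v w : Phi u v w = - Phi v u w.
Proof. by case: Phi_positive => A _ ->; apply: Phi0_skew12. Qed.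

(** For Phi = A^* Phi0 the pullback by A of the dot product is compatible, and A
intertwines the cross product of Phi with the standard one. The chosen metric
is therefore not the default value. *)
Lemma metric_compatible : compatible Phi (metric Phi).
Proof.
have [A A_unit PhiE] := Phi_positive.
have A_inj : injective (mulmx A : 'cV[R]_7 -> 'cV[R]_7).
  exact: can_inj (mulKmx A_unit).
have [dot_linearl dot_linearr dotC dot_gt0] := @dot_inner_product R.
pose g : form2 R := fun u v => dot (A *m u) (A *m v).
have g_inner : inner_product g.
  split=> [v a u w|u a v w|u v|u u0]; rewrite /g.
  - by rewrite mulmxDr -scalemxAr dot_linearl.
  - by rewrite mulmxDr -scalemxAr dot_linearr.
  - exact: dotC.
  - by apply: dot_gt0; rewrite -(mulmx0 _ A) (inj_eq A_inj).
have gX u v w : g (cross g Phi u v) w = Phi0 (A *m u) (A *m v) (A *m w).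
  by rewrite (crossE g_inner _ (positive_stable_linear3 u v)) PhiE.
have A_cross u v : A *m cross g Phi u v = cross0 (A *m u) (A *m v).
  rewrite -[RHS](mulKVmx A_unit); congr (A *m _).
  apply: (inner_product_inj g_inner) => w.
  by rewrite gX /g mulKVmx // dot_cross0.
have Phi0_self12 u v : Phi0 u u v = 0 :> R by have := Phi0_skew12 u u v; lra.
have Phi0_self23 u v : Phi0 u v v = 0 :> R by have := Phi0_skew23 u v v; lra.
apply: (xgetPex (fun _ _ => 0) (P := [set g | compatible Phi g]%classic)).
exists g; split=> //; split=> [u v|u v|u v|u v]; last 3 first.
- by rewrite /g A_cross dot_cross0 Phi0_skew23 Phi0_self12 oppr0.
- by rewrite /g A_cross dot_cross0.
- by rewrite /g A_cross cross0_norm.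
apply: (inner_product_inj g_inner) => w.
have [g_linearl _ _ _] := g_inner.
by rewrite (scalarN (g_linearl _)) !gX; apply: Phi0_skew12.
Qed.

(** In a unitary basis the product becomes the standard one, once
g(p, a x b) = Phi(a, b, p) is rewritten as Phi(p, a, b). *)
Lemma veebar_normal_form p : metric Phi p p = 1 ->
  exists2 M : 'M[R]_7, M \in unitmx &
  forall a b, veebar p Phi (M *m a) (M *m b) = M *m standard_product a b.
Proof.
move=> p1; have [g_inner [_ _ _ X_norm]] := metric_compatible.
set g := metric Phi in p1 g_inner X_norm *.
have gX u v w : g (cross g Phi u v) w = Phi u v w.
  exact/crossE/positive_stable_linear3.
have gC u v : g u v = g v u by case: g_inner.
have Php u : Phi p u p = 0.
  by rewrite positive_stable_skew23; have := positive_stable_skew12 p p u; lra.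
have [u|M M_unit [Mp Mg Mom]] :=
    unitary_normal_form g_inner (positive_stable_linear3 p)
      (positive_stable_skew23 p) Php (gX p) p1.
  by rewrite X_norm p1 mul1r (gC p).
have X_p a b : g p (cross g Phi a b) = Phi p a b.
  by rewrite gC gX positive_stable_skew23 positive_stable_skew12 opprK.
have gMp a : g (M *m a) p = dot a (delta_mx 0 0) by rewrite -Mg Mp.
exists M => // a b; rewrite /veebar -/g X_p !gMp Mg Mom /standard_product.
by rewrite !mulmxDr mulmxN -!scalemxAr Mp.
Qed.
End PositiveForms.

Theorem proposition3p16 (R : realType) (Phi Phi' : form3 R) (p p' : 'cV[R]_7) :
  positive_stable Phi -> positive_stable Phi' ->
  metric Phi p p = 1 -> metric Phi' p' p' = 1 ->
  algebra_isomorphic (veebar p Phi) (veebar p' Phi').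
Proof.
move=> Phi_pos Phi'_pos p1 p1'.
have [M M_unit MP] := veebar_normal_form Phi_pos p1.
have [M' M'_unit M'P] := veebar_normal_form Phi'_pos p1'.
exists (mulmx (M' *m invmx M)).
  exists (mulmx (M *m invmx M')) => u /=.
    by rewrite -!mulmxA mulKmx // mulKVmx.
  by rewrite -!mulmxA mulKmx // mulKVmx.
move=> a b /=; rewrite -{1}[a](mulKVmx M_unit) -{1}[b](mulKVmx M_unit) MP.
by rewrite -!mulmxA mulKmx // M'P.
Qed.
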